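(* If a set $A\subset\mathbb{N}$ has positive upper logarithmic density, i.e. $\limsup_{x\to\infty}\frac{1}{\log x}\sum_{n\in A,\,n\le x}\frac1n>0$, then $A$ contains an infinite L-divisibility chain.
   Context: For an integer $a>1$ let $P(a)$ denote its largest prime factor, and define the set of L-multiples $\mathrm{L}_a=\{ba: b\in\mathbb{N},\ \text{every prime } p\mid b \text{ satisfies } p\ge P(a)\}$ (so $a\in\mathrm{L}_a$, taking $b=1$). An infinite sequence of integers $1<d_1<d_2<\cdots$ is an L-divisibility chain if $d_{j+1}\in\mathrm{L}_{d_j}$ for all $j\ge1$. *)

(* Defs.v *)
From HB Require Import structures.
From mathcomp Require Import all_boot all_order all_algebra.
From mathcomp Require Import all_classical all_reals all_analysis.
Set Implicit Arguments. Unset Strict Implicit. Unset Printing Implicit Defensive.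
Import Order.TTheory GRing.Theory Num.Theory.

Definition P (a : nat) : nat := max_pdiv a.

Definition in_L (a m : nat) : Prop :=
  exists b : nat, 0 < b /\ m = b * a /\
    (forall p : nat, prime p -> p %| b -> P a <= p).

Definition L_chain (d : nat -> nat) : Prop :=
  1 < d 0 /\ (forall j, d j < d j.+1) /\ (forall j, in_L (d j) (d j.+1)).

Local Open Scope ring_scope.

Definition log_density_seq (R : realType) (A : pred nat) (x : nat) : \bar R :=
  ((\sum_(1 <= n < x.+1 | A n) (n%:R : R)^-1) / ln (x%:R : R))%:E.

Definition upper_log_density (R : realType) (A : pred nat) : \bar R :=
  limn_esup (log_density_seq R A).

(* Main.v *)
(* The sets [L_a] form a forest under inclusion: two of them are nested or
   disjoint, and [L_a] has density [w a = (1/a) * prod_(p < P a) (1 - 1/p)].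
   Hence [w] has sum at most 1 over the elements of [A] that are minimal for
   L-divisibility. By Mertens' bound [prod_(p <= x) (1 - 1/p)^-1 = O(ln x)], the
   harmonic sum of [L_a] up to [x] is [O(w a * ln x)] uniformly in [a]; so the
   [L_a] with [a] minimal and large have arbitrarily small upper logarithmic
   density together, and some [L_a] with [a] in [A] must meet [A] in positive
   upper logarithmic density. Iterating inside this intersection gives the chain. *)
Require Import Defs.
From mathcomp Require Import all_boot all_order all_algebra.
From mathcomp Require Import all_classical all_reals all_analysis.
From mathcomp Require Import ring lra zify.
Set Implicit Arguments. Unset Strict Implicit. Unset Printing Implicit Defensive.
Import Order.TTheory GRing.Theory Num.Theory numFieldNormedType.Exports.

(** * L-divisibility: transitivity and nesting *)

Lemma in_L_dvdn a n : in_L a n -> a %| n.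
Proof. by move=> [b [_ [-> _]]]; exact: dvdn_mull. Qed.

Lemma in_L_refl a : 0 < a -> in_L a a.
Proof.
move=> a0; exists 1; rewrite mul1n; split=> //; split=> // p pp.
by rewrite dvdn1 => /eqP p1; rewrite p1 in pp.
Qed.

Lemma P_prime a : 1 < a -> prime (P a).
Proof. exact: max_pdiv_prime. Qed.

Lemma dvdn_leq_P a p : 0 < a -> prime p -> p %| a -> p <= P a.
Proof. by move=> a0 pp pa; apply: max_pdiv_max; rewrite mem_primes pp a0. Qed.

(** [P a] is a prime factor of [b], so [P a <= P b] and the primes of the second cofactor are large
    enough for [a]. *)
Lemma in_L_trans a b c : 1 < a -> in_L a b -> in_L b c -> in_L a c.
Proof.
move=> a1 [u [u0 [-> hu]]] [v [v0 [-> hv]]].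
exists (v * u); rewrite muln_gt0 v0 u0 mulnA; split=> //; split=> // p pp.
rewrite Euclid_dvdM // => /orP[pv|]; last exact: hu.
apply: leq_trans (hv p pp pv); apply: dvdn_leq_P; rewrite ?muln_gt0 ?u0 ?(ltnW a1) //.
  exact: P_prime.
exact/dvdn_mull/max_pdiv_dvd.
Qed.

(* If [d] is the gcd of [a] and [a'], a prime factor of [a %/ d] divides the
   cofactor of [a'] in [n], and conversely; so if neither divides the other,
   both largest primes coincide, contradicting the coprimality of [a %/ d] and
   [a' %/ d]. *)
Lemma in_L_nested a a' n : 1 < a -> a <= a' -> in_L a n -> in_L a' n -> in_L a a'.
Proof.
move=> a1 aa' [b [b0 [nE hb]]] [b' [b'0 [nE' hb']]].
have a0 : 0 < a by exact: ltnW.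
have a'0 : 0 < a' by exact: leq_trans aa'.
have d0 : 0 < gcdn a a' by rewrite gcdn_gt0 a0.
set d := gcdn a a' in d0; set u := a %/ d; set u' := a' %/ d.
have aE : a = u * d by rewrite divnK // dvdn_gcdl.
have a'E : a' = u' * d by rewrite divnK // dvdn_gcdr.
have u0 : 0 < u by move: a0; rewrite aE muln_gt0 => /andP[].
have u'0 : 0 < u' by move: a'0; rewrite a'E muln_gt0 => /andP[].
have cuu' : coprime u u'.
  by rewrite /coprime -(eqn_pmul2r d0) muln_gcdl -aE -a'E mul1n.
have E : b * u = b' * u'.
  by apply/eqP; rewrite -(eqn_pmul2r d0) -!mulnA -aE -a'E -nE -nE'.
have ub' : u %| b' by rewrite -(Gauss_dvdl _ cuu') -E dvdn_mull.
have u'b : u' %| b by rewrite -(@Gauss_dvdl _ _ u) 1?coprime_sym // E dvdn_mull.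
have [u1|u1] := leqP u 1.
  exists u'; split=> //; split.
    by rewrite aE (_ : u = 1) ?mul1n //; apply/eqP; rewrite eqn_leq u1.
  by move=> p pp pu'; apply: hb => //; exact: dvdn_trans u'b.
have [u'1|u'1] := leqP u' 1.
  have a'a : a' <= a.
    by rewrite a'E (_ : u' = 1) ?mul1n ?aE ?leq_pmull //; apply/eqP; rewrite eqn_leq u'1.
  have -> : a' = a by apply/eqP; rewrite eqn_leq aa' a'a.
  exact: in_L_refl.
have pu := pdiv_prime u1; have pu' := pdiv_prime u'1.
have h1 : P a' <= pdiv u by apply: hb' => //; exact: dvdn_trans (pdiv_dvd _) ub'.
have h2 : P a <= pdiv u' by apply: hb => //; exact: dvdn_trans (pdiv_dvd _) u'b.
have h3 : pdiv u <= P a.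
  by apply: dvdn_leq_P => //; rewrite aE dvdn_mulr // pdiv_dvd.
have h4 : pdiv u' <= P a'.
  by apply: dvdn_leq_P => //; rewrite a'E dvdn_mulr // pdiv_dvd.
have e : pdiv u = pdiv u' by lia.
have : pdiv u %| gcdn u u' by rewrite dvdn_gcd pdiv_dvd e pdiv_dvd.
by rewrite (eqP cuu') dvdn1 => /eqP e1; rewrite e1 in pu.
Qed.

(** * Integers whose prime factors all lie in an interval *)

Definition rough (q y n : nat) : bool := all (fun p => q <= p < y) (primes n).

Lemma roughP q y n : 0 < n ->
  reflect (forall p, prime p -> p %| n -> q <= p < y) (rough q y n).
Proof.
move=> n0; apply: (iffP allP) => H p.
  by move=> pp pn; apply: H; rewrite mem_primes pp n0.
by rewrite mem_primes => /and3P[pp _ pn]; exact: H.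
Qed.

Lemma rough_mul q y p n : prime p -> q <= p < y -> 0 < n ->
  rough q y (p * n) = rough q y n.
Proof.
move=> pp qpy n0; have pn0 : 0 < p * n by rewrite muln_gt0 prime_gt0.
apply/roughP/roughP => // H r.
  by move=> rp rn; apply: H => //; exact: dvdn_mull.
move=> rp; rewrite Euclid_dvdM // => /orP[|]; last exact: H.
by rewrite dvdn_prime2 // => /eqP ->.
Qed.

Lemma roughS q y n : prime q -> q < y -> 0 < n ->
  rough q y n && ~~ (q %| n) = rough q.+1 y n.
Proof.
move=> pq qy n0; apply/andP/roughP => //.
  move=> [/roughP-/(_ n0) H qn] p pp pn.
  have /andP[qp py] := H p pp pn; rewrite py andbT ltn_neqAle qp andbT.
  by apply/eqP => e; rewrite e pn in qn.
move=> H; split; last by apply/negP => /(H _ pq); rewrite ltnn.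
by apply/roughP => // p pp /(H p pp) /andP[/ltnW -> ->].
Qed.

Lemma roughS_nprime q y n : ~~ prime q -> 0 < n -> rough q y n = rough q.+1 y n.
Proof.
move=> nq n0; apply/roughP/roughP => // H p pp /(H p pp) /andP[qp ->]; rewrite andbT.
  by rewrite ltn_neqAle qp andbT; apply: contraNneq nq => ->.
exact: ltnW.
Qed.

Lemma rough_id q n : 0 < n -> rough q q n = (n == 1).
Proof.
move=> n0; apply/roughP/eqP => // [H|-> p pp].
  apply/eqP; rewrite eqn_leq n0 andbT leqNgt; apply/negP => n1.
  by have := H _ (pdiv_prime n1) (pdiv_dvd n); lia.
by rewrite dvdn1 => /eqP p1; rewrite p1 in pp.
Qed.

Local Open Scope ring_scope.

Lemma big_dvdn_reindex (V : nmodType) (d N : nat) (Q : pred nat) (F : nat -> V) :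
  (0 < d)%N ->
  \sum_(1 <= n < N.+1 | (d %| n)%N && Q n) F n =
  \sum_(1 <= m < (N %/ d).+1 | Q (d * m)%N) F (d * m)%N.
Proof.
move=> d0; rewrite -big_filter_cond.
rewrite -(big_map (fun m => d * m)%N Q F) /=.
apply: perm_big; apply: uniq_perm.
- by rewrite filter_uniq // iota_uniq.
- rewrite map_inj_uniq ?iota_uniq // => x y /eqP; rewrite eqn_mul2l.
  by case: d d0 => // d _ /= /eqP.
- move=> n; rewrite mem_filter mem_index_iota; apply/idP/mapP.
    move=> /and3P[/dvdnP[m ->] m0 mN]; exists m; last by rewrite mulnC.
    by rewrite mem_index_iota; move: m0; rewrite muln_gt0 ltnS leq_divRL // => /andP[-> _] /=.
  move=> [m]; rewrite mem_index_iota ltnS leq_divRL // => /andP[m0 mN] ->.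
  by rewrite dvdn_mulr // muln_gt0 d0 m0 ltnS mulnC.
Qed.

(** * Finite Euler products of completely multiplicative functions *)

Section EulerProduct.
Variables (R : realType) (f : nat -> R).
Hypothesis f1 : f 1%N = 1.
Hypothesis f_ge0 : forall n, 0 <= f n.
Hypothesis f_lt1 : forall p, prime p -> f p < 1.
Hypothesis fM : forall m n, (0 < m)%N -> (0 < n)%N -> f (m * n)%N = f m * f n.

Definition rough_sum (q y N : nat) : R := \sum_(1 <= n < N.+1 | rough q y n) f n.

Definition euler_prod (q y : nat) : R := \prod_(q <= p < y | prime p) (1 - f p)^-1.

Lemma ler_rough_sum q y M N : (M <= N)%N -> rough_sum q y M <= rough_sum q y N.
Proof.
move=> MN; rewrite /rough_sum (@big_cat_nat _ _ _ M.+1 _ N.+1) //=.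
by rewrite lerDl sumr_ge0.
Qed.

Lemma euler_prod_gt0 q y : 0 < euler_prod q y.
Proof. by apply: prodr_gt0 => p /f_lt1 ?; rewrite invr_gt0 subr_gt0. Qed.

Lemma euler_prod_cat q r y : (q <= r <= y)%N ->
  euler_prod q y = euler_prod q r * euler_prod r y.
Proof. by move=> /andP[qr ry]; rewrite /euler_prod (big_cat_nat qr ry). Qed.

(** Sorting by divisibility by [q]: the multiples are the [q * m] with [m <= N %/ q], where [m] may
    again be divisible by [q]. *)
Lemma rough_sumS q y N : prime q -> (q < y)%N ->
  rough_sum q y N = rough_sum q.+1 y N + f q * rough_sum q y (N %/ q).
Proof.
move=> pq qy; rewrite /rough_sum (bigID (fun n => (q %| n)%N)) /= addrC; congr (_ + _).
  by apply: congr_big_nat => // n /andP[n0 _]; exact: roughS.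
under eq_bigl do rewrite andbC.
rewrite big_dvdn_reindex ?prime_gt0 // big_distrr /=.
apply: congr_big_nat => // n; first by move=> /andP[n0 _]; rewrite rough_mul ?leqnn.
by move=> /and3P[_ n0 _]; rewrite fM // prime_gt0.
Qed.

Lemma rough_sumS_nprime q y N : ~~ prime q -> rough_sum q y N = rough_sum q.+1 y N.
Proof.
by move=> nq; apply: congr_big_nat => // n /andP[n0 _]; exact: roughS_nprime.
Qed.

Lemma rough_sum_id q N : (0 < N)%N -> rough_sum q q N = 1.
Proof.
move=> N0; rewrite /rough_sum big_ltn_cond // /rough /= f1 big_nat_cond big1 ?addr0 //.
by move=> n /andP[/andP[n1 _]]; rewrite -/(rough q q n) rough_id ?(ltnW n1) //; lia.
Qed.

Lemma euler_prodS q y : prime q -> (q < y)%N ->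
  euler_prod q y = (1 - f q)^-1 * euler_prod q.+1 y.
Proof. by move=> pq qy; rewrite /euler_prod big_ltn_cond // pq. Qed.

Lemma euler_prodS_nprime q y : ~~ prime q -> (q < y)%N ->
  euler_prod q y = euler_prod q.+1 y.
Proof. by move=> /negbTE pq qy; rewrite /euler_prod big_ltn_cond // pq. Qed.

(** Induction on [y - q]. Since [N %/ q <= N], [rough_sumS] bounds [(1 - f q) * rough_sum q y N] by
    the sum without the prime [q]. *)
Lemma rough_sum_le_euler q y N : (q <= y)%N -> rough_sum q y N <= euler_prod q y.
Proof.
move=> qy; rewrite -(subnK qy); move: (y - q)%N => k; elim: k q N {y qy} => [|k IH] q N.
  rewrite add0n /euler_prod big_geq //; case: N => [|N]; last by rewrite rough_sum_id.
  by rewrite /rough_sum big_geq.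
have qk : (q < k.+1 + q)%N by rewrite addSn ltnS leq_addl.
have {}IH := IH q.+1; rewrite addnS -addSn in IH.
have [pq|npq] := boolP (prime q); last by rewrite rough_sumS_nprime // euler_prodS_nprime.
rewrite euler_prodS // ler_pdivlMl ?subr_gt0 ?f_lt1 //.
rewrite mulrBl mul1r lerBlDr.
apply: (@le_trans _ _ (rough_sum q.+1 (k.+1 + q) N + f q * rough_sum q (k.+1 + q) N)).
  rewrite {1}rough_sumS // lerD2l; apply: ler_wpM2l => //.
  by apply: ler_rough_sum; exact: leq_div.
by rewrite lerD2r.
Qed.

(** The sums increase and are bounded by the product, so they have a limit; passing to the limit in
    [rough_sumS] shows that it is no smaller than the product. *)
Lemma cvg_rough_sum q y : (q <= y)%N ->
  (rough_sum q y N @[N --> \oo] --> euler_prod q y)%classic.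
Proof.
move=> qy; rewrite -(subnK qy); move: (y - q)%N => k; elim: k q {y qy} => [|k IH] q.
  rewrite add0n /euler_prod big_geq //; apply: cvg_near_cst.
  by exists 1%N => // N /= N0; rewrite rough_sum_id.
have qk : (q < k.+1 + q)%N by rewrite addSn ltnS leq_addl.
have {}IH := IH q.+1; rewrite addnS -addSn in IH.
have [pq|npq] := boolP (prime q); last first.
  by rewrite euler_prodS_nprime //; under eq_fun do rewrite rough_sumS_nprime //.
set y := (k.+1 + q)%N in qk IH *.
have mono : {homo rough_sum q y : m n / (m <= n)%N >-> m <= n}.
  by move=> m n; exact: ler_rough_sum.
have cv : cvgn (rough_sum q y).
  apply: nondecreasing_is_cvgn => //; exists (euler_prod q y) => _ [N _ <-].
  by apply: rough_sum_le_euler; exact: ltnW.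
suff <- : limn (rough_sum q y) = euler_prod q y by [].
apply/eqP; rewrite eq_le; apply/andP; split.
  by apply: limr_le => //; near=> N; apply: rough_sum_le_euler; exact: ltnW.
rewrite euler_prodS // ler_pdivrMl ?subr_gt0 ?f_lt1 // mulrBl mul1r lerBrDr.
have cvT : (rough_sum q.+1 y N + f q * rough_sum q y N @[N --> \oo] -->
    euler_prod q.+1 y + f q * limn (rough_sum q y))%classic.
  by apply: cvgD => //; exact: cvgMl_tmp.
apply: (cvgr_to_le cvT); near=> N => /=.
(* At the cutoff [q * N] the quotient in [rough_sumS] is exactly [N]. *)
apply: le_trans (nondecreasing_cvgn_le mono cv (q * N)%N).
rewrite (rough_sumS (q * N)) // mulKn ?prime_gt0 // lerD2r.
by apply: ler_rough_sum; rewrite leq_pmull ?prime_gt0.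
Unshelve. all: by end_near. Qed.

End EulerProduct.

(** * Mertens' upper bound for the product over primes *)

Section Mertens.
Variable R : realType.

Definition ninv (n : nat) : R := (n%:R)^-1.

Lemma ninv1 : ninv 1 = 1. Proof. by rewrite /ninv invr1. Qed.

Lemma ninv_ge0 n : 0 <= ninv n. Proof. by rewrite invr_ge0. Qed.

Lemma ninvM m n : ninv (m * n) = ninv m * ninv n.
Proof. by rewrite /ninv natrM invfM. Qed.

Lemma ninv_prime_le p : prime p -> ninv p <= 2^-1.
Proof. by move=> pp; rewrite lef_pV2 ?posrE ?ltr0n ?ler_nat ?prime_gt0 ?prime_gt1. Qed.

Lemma ninv_lt1 p : prime p -> ninv p < 1.
Proof. by move=> /ninv_prime_le h; lra. Qed.

Lemma ln_nat_ge0 n : 0 <= ln (n%:R : R).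
Proof.
by case: n => [|n]; [rewrite ln0|rewrite ln_ge0 // ler1n].
Qed.

Lemma ln_fact_le n : ln (n`!%:R : R) <= n%:R * ln (n%:R : R).
Proof.
case: n => [|n]; first by rewrite ln1 mul0r.
rewrite mulrC mulr_natr -lnXn ?ltr0n // ler_ln ?posrE ?exprn_gt0 ?ltr0n ?fact_gt0 //.
rewrite -natrX ler_nat; elim: n.+1 => // k IH.
rewrite factS expnS leq_mul2l /=; apply: leq_trans IH _.
by case: k => // k; rewrite leq_exp2r.
Qed.

(** Legendre's formula for the exponent of [p] in [n!], keeping only its first term [n %/ p]. *)
Lemma prod_prime_expn_fact_le n :
  (\prod_(1 <= p < n.+1 | prime p) p ^ (n %/ p) <= n`!)%N.
Proof.
rewrite -[leqRHS](partnT (fact_gt0 n)) (@widen_partn n`!) //.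
rewrite (@big_cat_nat _ _ _ n.+1 0 n`!.+1) ?ltnS ?fact_geq //=.
apply: (@leq_trans (\prod_(0 <= p < n.+1) p ^ logn p n`!)); last first.
  by rewrite leq_pmulr // prodn_gt0.
rewrite big_ltn // lognE /= mul1n.
rewrite big_mkcond /= big_nat_cond [leqRHS]big_nat_cond.
apply: leq_prod => p /andP[/andP[p0 pn] _]; case: ifP => [pp|_]; last by rewrite expn_gt0 p0.
rewrite leq_pexp2l // logn_fact //; case: n p0 pn => [|n] p0 pn; first by lia.
by rewrite big_ltn // expn1 leq_addr.
Qed.

Lemma ln_fact_ge n :
  \sum_(1 <= p < n.+1 | prime p) (n %/ p)%:R * ln (p%:R : R) <= ln (n`!%:R : R).
Proof.
rewrite -ler_expR lnK ?posrE ?ltr0n ?fact_gt0 // expR_sum.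
rewrite (eq_bigr (fun p => (p ^ (n %/ p))%:R)) => [|p pp]; last first.
  by rewrite expRM_natl lnK ?natrX // posrE ltr0n prime_gt0.
by rewrite -natr_prod ler_nat prod_prime_expn_fact_le.
Qed.

(** Compare two bounds for [ln n!]. The factor 2 comes from removing the floor:
    [n <= 2 * p * (n %/ p)] when [0 < p <= n]. *)
Lemma sum_prime_ln_le n :
  \sum_(1 <= p < n.+1 | prime p) ln (p%:R : R) / p%:R <= 2 * ln (n%:R : R).
Proof.
have [->|n0] := posnP n; first by rewrite big_geq // ln0 ?mulr0.
have n0R : (0 : R) < n%:R by rewrite ltr0n.
rewrite -(ler_pM2l n0R) mulrCA -ler_pdivrMl //.
apply: le_trans (le_trans (ln_fact_ge n) (ln_fact_le n)).
rewrite mulrA big_distrr /= big_nat_cond [leRHS]big_nat_cond.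
apply: ler_sum => p /andP[/andP[p0 pn] pp].
rewrite mulrCA mulrC ler_wpM2r ?ln_nat_ge0 // ler_pdivrMr ?ltr0n // ler_pdivrMl //.
rewrite -!natrM ler_nat.
have := divn_eq n p; have := ltn_pmod n p0.
have : (0 < n %/ p)%N by rewrite divn_gt0.
nia.
Qed.

(* Rankin's trick: [powN s n] is [n^-(1+s)]; taking [s = 1 / ln x] costs only a
   bounded factor on primes up to [x], while the full sum is at most [1 + 1/s]. *)
Definition powN (s : R) (n : nat) : R := ninv n * expR (- s * ln n%:R).

Lemma powN1 s : powN s 1 = 1.
Proof. by rewrite /powN ln1 mulr0 expR0 ninv1 mulr1. Qed.

Lemma powN_ge0 s n : 0 <= powN s n.
Proof. by rewrite mulr_ge0 ?ninv_ge0 ?expR_ge0. Qed.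

Lemma powNM s m n : (0 < m)%N -> (0 < n)%N -> powN s (m * n) = powN s m * powN s n.
Proof.
move=> m0 n0; rewrite /powN ninvM natrM lnM ?posrE ?ltr0n // mulrDr expRD; ring.
Qed.

Lemma powN_le s n : 0 <= s -> powN s n <= ninv n.
Proof.
move=> s0; rewrite /powN ler_piMr ?ninv_ge0 // -[leRHS]expR0 ler_expR mulNr oppr_le0.
by rewrite mulr_ge0 // ln_nat_ge0.
Qed.

Lemma sum_powN_le s N : 0 < s -> \sum_(1 <= n < N.+1) powN s n <= 1 + s^-1.
Proof.
move=> s0.
(* This is the comparison with the integral of [t^-(1+s)] from 1 to [N + 1]; its explicit form makes
   the induction telescope. *)
suff H : \sum_(1 <= n < N.+2) powN s n <= 1 + s^-1 * (1 - expR (- s * ln N.+1%:R)).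
  case: N H => [|N] H; first by rewrite big_geq // addr_ge0 // invr_ge0 ltW.
  rewrite big_nat_recr //= in H.
  have h1 : 0 <= powN s N.+2 := powN_ge0 _ _.
  have h2 : 0 <= s^-1 * expR (- s * ln N.+2%:R).
    by rewrite mulr_ge0 ?expR_ge0 // invr_ge0 ltW.
  by move: H; rewrite mulrBr mulr1; lra.
elim: N => [|N IH]; first by rewrite big_nat1 powN1 ln1 mulr0 expR0 subrr mulr0 addr0.
rewrite big_nat_recr //=.
suff : powN s N.+2 <= s^-1 * (expR (- s * ln N.+1%:R) - expR (- s * ln N.+2%:R)).
  by move: IH; rewrite !mulrBr !mulr1; lra.
rewrite ler_pdivlMl // /powN; set E := expR (- s * ln N.+2%:R).
have -> : expR (- s * ln N.+1%:R) = E * expR (s * (ln N.+2%:R - ln N.+1%:R)).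
  by rewrite -expRD; congr expR; ring.
(* After factoring out [(N+2)^-s], what remains follows from [e^t >= 1 + t] and [ln (1 - u) <= - u]
   with [u = 1 / (N+2)]. *)
suff : s * ninv N.+2 <= expR (s * (ln N.+2%:R - ln N.+1%:R)) - 1.
  move=> h; have := ler_wpM2l (expR_ge0 (- s * ln N.+2%:R)) h; rewrite -/E; lra.
rewrite lerBrDl; apply: le_trans (expR_ge1Dx _); rewrite lerD2l ler_pM2l //.
have e : N.+1%:R = N.+2%:R * (1 - ninv N.+2) :> R.
  by rewrite mulrBr mulr1 /ninv mulfV // -[N.+2]addn1 natrD addrK.
have n1 : ninv N.+2 < 1 by rewrite invf_lt1 ?ltr0n // ltr1n.
have : ln (1 + - ninv N.+2) <= - ninv N.+2 by apply: le_ln1Dx; lra.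
rewrite e lnM ?posrE ?ltr0n ?subr_gt0 //; lra.
Qed.

(** Linearise [p^-s] from below by [1 - s ln p]. Because [1 - 1/p >= 1/2], the error [s ln p / p] is
    absorbed in [(1 - 1/p) * 2 s ln p / p]. *)
Lemma one_sub_powN_le s p : 0 <= s -> prime p ->
  1 - powN s p <= (1 - ninv p) * expR (2 * s * (ln p%:R / p%:R)).
Proof.
move=> s0 pp; have h := ninv_prime_le pp; have h0 := ninv_ge0 p.
have hl := ln_nat_ge0 p.
have h1 : 1 - s * ln p%:R <= expR (- s * ln p%:R) by rewrite -mulNr; exact: expR_ge1Dx.
have h2 := ler_wpM2l h0 h1.
apply: le_trans (_ : (1 - ninv p) * (1 + 2 * s * (ln p%:R / p%:R)) <= _); last first.
  by rewrite ler_wpM2l ?expR_ge1Dx //; lra.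
rewrite /powN -/(ninv p).
have h3 : 0 <= s * (ln p%:R * ninv p) by rewrite !mulr_ge0.
have := ler_wpM2r h3 h; lra.
Qed.

(** With [s = 1 / ln x] the product for [powN s] is at most [1 + ln x <= 2 ln x]. Passing to [ninv]
    costs [exp (2 s * sum of ln p / p)], at most [exp 4] by [sum_prime_ln_le]. *)
Lemma euler_prod_le x : 1 <= ln (x%:R : R) ->
  euler_prod ninv 0 x.+1 <= 2 * expR 4 * ln x%:R.
Proof.
move=> lx1.
set s : R := (ln x%:R)^-1.
have s0 : 0 < s by rewrite invr_gt0; lra.
have powN_lt1 p : prime p -> powN s p < 1.
  by move=> pp; apply: le_lt_trans (powN_le _ (ltW s0)) (ninv_lt1 pp).
have h1 : euler_prod (powN s) 0 x.+1 <= 2 * ln x%:R.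
  have := cvg_rough_sum (powN1 s) (powN_ge0 s) powN_lt1 (@powNM s) (leq0n x.+1).
  move=> /cvgr_to_le; apply; near=> N.
  apply: (@le_trans _ _ (1 + s^-1)); last by rewrite invrK; lra.
  apply: le_trans (sum_powN_le N s0); rewrite /rough_sum big_mkcond /=.
  by apply: ler_sum => n _; case: ifP => // _; exact: powN_ge0.
have h2 : euler_prod ninv 0 x.+1 <= expR 4 * euler_prod (powN s) 0 x.+1.
  apply: (@le_trans _ _ (\prod_(0 <= p < x.+1 | prime p)
      (expR (2 * s * (ln p%:R / p%:R)) * (1 - powN s p)^-1))).
    apply: ler_prod => p pp.
    have i1 : 0 < 1 - ninv p by rewrite subr_gt0 ninv_lt1.
    have i2 : 0 < 1 - powN s p by rewrite subr_gt0 powN_lt1.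
    rewrite invr_ge0 ltW //= ler_pdivlMr // ler_pdivrMl //.
    exact: one_sub_powN_le (ltW s0) pp.
  rewrite big_split /= ler_pM2r ?euler_prod_gt0 // -expR_sum ler_expR -big_distrr /=.
  rewrite big_ltn_cond //=.
  apply: le_trans (ler_wpM2l _ (sum_prime_ln_le x)) _; first by rewrite mulr_ge0 // ltW.
  have sl : s * ln x%:R = 1 by rewrite mulVf //; lra.
  lra.
rewrite [2 * _]mulrC -mulrA; apply: le_trans h2 _.
by rewrite ler_wpM2l ?expR_ge0.
Unshelve. all: by end_near. Qed.

End Mertens.

(** * Harmonic sums and densities of the sets of L-multiples *)

Definition in_Lb (a n : nat) : bool := `[< in_L a n >].

(** Primes dividing [m] are below any [y > m], so the upper bound in [rough] costs nothing and
    finite Euler products apply. *)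
Lemma in_Lb_mul a m y : (0 < a)%N -> (0 < m < y)%N ->
  in_Lb a (a * m) = rough (P a) y m.
Proof.
move=> a0 /andP[m0 my]; apply/asboolP/roughP => //.
  move=> [b [b0 [E hb]]] p pp pm; move: E; rewrite mulnC => /eqP.
  rewrite eqn_pmul2r // => /eqP E; rewrite hb // -?E //=.
  exact: leq_ltn_trans (dvdn_leq m0 pm) my.
move=> H; exists m; split=> //; split; first by rewrite mulnC.
by move=> p pp pm; have /andP[] := H p pp pm.
Qed.

Section LogDensity.
Variable R : realType.
Local Notation ninv := (@ninv R).
Local Notation V := (euler_prod ninv).

Lemma V_gt0 q y : 0 < V q y.
Proof. exact/euler_prod_gt0/ninv_lt1. Qed.

(* the natural density of [L_a], written with [V] to avoid a reciprocal product *)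
Definition L_density (a : nat) : R := ninv a / V 0 (P a).

Lemma L_density_ge0 a : 0 <= L_density a.
Proof. by rewrite divr_ge0 ?ninv_ge0 // ltW ?V_gt0. Qed.

(** Splitting [V 0 y] at [P a] cancels the denominator. The right side is the full reciprocal sum of
    the [a * m] with all primes of [m] in [[P a, y)]. *)
Lemma L_density_mul a y : (P a <= y)%N -> L_density a * V 0 y = ninv a * V (P a) y.
Proof.
move=> Pay; rewrite /L_density (@euler_prod_cat _ _ 0 (P a) y) ?Pay // mulrA divfK //.
by rewrite gt_eqF ?V_gt0.
Qed.

Lemma P_leq a : (0 < a)%N -> (P a <= a)%N.
Proof. by move=> a0; apply: dvdn_leq => //; exact: max_pdiv_dvd. Qed.

(** The cofactors are at most [x %/ a], with primes in [[P a, x]], so an Euler product dominates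
    their sum with no error term depending on [a]. *)
Lemma L_sum_le a x : (1 < a <= x)%N ->
  \sum_(1 <= n < x.+1 | in_Lb a n) ninv n <= L_density a * V 0 x.+1.
Proof.
move=> /andP[a1 ax]; have a0 := ltnW a1.
have Pax : (P a <= x.+1)%N by rewrite ltnW // ltnS (leq_trans (P_leq a0)).
rewrite L_density_mul //.
under eq_bigl => n.
  rewrite (_ : in_Lb a n = (a %| n)%N && in_Lb a n); first over.
  by apply/esym/andb_idl => /asboolP; exact: in_L_dvdn.
rewrite big_dvdn_reindex //.
have := rough_sum_le_euler (ninv1 R) (@ninv_ge0 R) (@ninv_lt1 R)
  (fun m n _ _ => ninvM R m n) (x %/ a) Pax.
move=> /(ler_wpM2l (ninv_ge0 R a)); apply: le_trans.
rewrite /rough_sum big_distrr /= le_eqVlt; apply/orP; left; apply/eqP.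
apply: congr_big_nat => // m; last by rewrite ninvM.
move=> /andP[m0 mx]; apply: in_Lb_mul => //; rewrite m0 /=.
by rewrite (leq_trans mx) // ltnS leq_div.
Qed.

Definition L_primitive (S : pred nat) : Prop :=
  (forall a, S a -> (1 < a)%N) /\
  (forall a a', S a -> S a' -> in_L a a' -> a = a').

(** By [in_L_nested] the smaller of the two L-divides the larger. *)
Lemma L_primitive_uniq S a a' n : L_primitive S -> S a -> S a' ->
  in_L a n -> in_L a' n -> a = a'.
Proof.
move=> [S1 SL] Sa Sa' an a'n; case: (leqP a a') => aa'.
  by apply: SL => //; apply: in_L_nested an a'n => //; exact: S1.
by apply/esym/SL => //; apply: in_L_nested a'n an; [exact: S1|exact: ltnW].
Qed.

Lemma L_primitive_sum_le S n K (c : R) : L_primitive S -> 0 <= c ->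
  \sum_(1 <= a < K | S a && in_Lb a n) c <= c.
Proof.
move=> SL c0; have [[a /and3P[aK Sa an]]|H] :=
    pselect (exists a, [&& 0 < a < K, S a & in_Lb a n]%N); last first.
  rewrite big_nat_cond big1 // => a /and3P[aK Sa an].
  by exfalso; apply: H; exists a; apply/and3P.
rewrite big_mkcond (bigD1_seq a) /= ?mem_index_iota ?iota_uniq // Sa an /=.
rewrite big1 ?addr0 // => b ba; case: ifP => // /andP[Sb bn].
by case/eqP: ba; apply: (L_primitive_uniq SL Sb Sa (n := n)); exact/asboolP.
Qed.

(* The sets [L_a] with [a] in [S] are disjoint, and their densities are read
   off on the numbers whose primes are at most [K]. *)
Lemma L_primitive_density_le1 S K : L_primitive S ->
  \sum_(1 <= a < K.+1 | S a) L_density a <= 1.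
Proof.
move=> SL; have [S1 _] := SL; have V0 := V_gt0 0 K.+1.
rewrite -(ler_pM2r V0) mul1r big_distrl /=.
rewrite big_nat_cond (eq_bigr (fun a => ninv a * V (P a) K.+1)) => [|a]; last first.
  move=> /andP[/andP[a0 aK] _]; apply: L_density_mul.
  exact: ltnW (leq_ltn_trans (P_leq a0) aK).
have cv : (\sum_(1 <= a < K.+1 | (0 < a < K.+1)%N && S a)
    ninv a * rough_sum ninv (P a) K.+1 N @[N --> \oo] -->
    \sum_(1 <= a < K.+1 | (0 < a < K.+1)%N && S a) ninv a * V (P a) K.+1)%classic.
  apply: cvg_big => [|a /andP[/andP[a0 aK] _]]; first exact: add_continuous.
  apply: cvgMl_tmp; apply: cvg_rough_sum => //.
  - exact: ninv1.
  - exact: ninv_ge0.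
  - exact: ninv_lt1.
  - by move=> m n _ _; exact: ninvM.
  - exact: ltnW (leq_ltn_trans (P_leq a0) aK).
apply: (cvgr_to_le cv); near=> N.
(* The cutoff [N * K] is common to all [a]: it covers every [a * m] with [a <= K] and [m <= N], and
   such a product has all its primes at most [K]. *)
apply: (@le_trans _ _ (\sum_(1 <= a < K.+1 | S a)
    \sum_(1 <= n < (N * K).+1 | rough 0 K.+1 n && in_Lb a n) ninv n)).
  rewrite [leRHS]big_nat_cond; apply: ler_sum => a /andP[/andP[a0 aK] Sa].
  rewrite (eq_bigl (fun n => (a %| n)%N && (rough 0 K.+1 n && in_Lb a n))); last first.
    move=> n; apply/esym/andb_idl => /andP[_ /asboolP]; exact: in_L_dvdn.
  rewrite big_dvdn_reindex // /rough_sum big_distrr /=.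
  have NK : (N <= N * K %/ a)%N by rewrite leq_divRL // leq_mul2l -ltnS aK orbT.
  rewrite (@big_nat_widen _ _ _ 1 N.+1 (N * K %/ a).+1) //.
  rewrite big_mkcond [leRHS]big_mkcond /=; rewrite big_nat [leRHS]big_nat /=.
  apply: ler_sum => m /andP[m0 _]; case: ifP => [/andP[rm mN]|_]; last first.
    by case: ifP => // _; exact: ninv_ge0.
  rewrite ifT ?ninvM //; apply/andP; split.
    apply/roughP; rewrite ?muln_gt0 ?a0 // => p pp; rewrite Euclid_dvdM // => /orP[pa|pm].
      by rewrite /= (leq_ltn_trans _ aK) // dvdn_leq.
    by move/roughP: rm => /(_ m0 p pp pm)/andP[].
  apply/asboolP; exists m; split=> //; split; first by rewrite mulnC.
  by move=> p pp pm; move/roughP: rm => /(_ m0 p pp pm)/andP[].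
(* Summing over [n] first, disjointness counts each [n] at most once, and the total is at most
   [V 0 K.+1]. *)
rewrite (exchange_big_dep_nat (rough 0 K.+1)) /=; last by move=> a n _ _ _ /andP[].
apply: le_trans (rough_sum_le_euler (ninv1 R) (@ninv_ge0 R) (@ninv_lt1 R)
  (fun m n _ _ => ninvM R m n) (N * K) (leq0n K.+1)).
apply: ler_sum => n rn; under eq_bigl do rewrite rn /=.
exact: L_primitive_sum_le (ninv_ge0 R n).
Unshelve. all: by end_near. Qed.

End LogDensity.

(** * One step of the chain: finding a member whose L-multiples keep positive density *)

Section ChainStep.
Variable R : realType.
Local Notation ninv := (@ninv R).

(** Positive upper logarithmic density without limsup or extended reals: one constant serves along
    arbitrarily large [x]. *)
Definition log_positive (A : pred nat) : Prop :=
  exists2 d : R, 0 < d & forall N, exists2 x, (N <= x)%N &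
    d * ln x%:R <= \sum_(1 <= n < x.+1 | A n) ninv n.

Lemma log_positive_of_upper_log_density A :
  (0 < upper_log_density R A)%E -> log_positive A.
Proof.
move=> L0.
have [d d0 dL] : exists2 d : R, 0 < d & (d%:E < upper_log_density R A)%E.
  move: L0; case: upper_log_density => [r| |] // r0.
    by exists (r / 2); rewrite ?lte_fin; move: r0; rewrite lte_fin; lra.
  by exists 1; rewrite ?ltry.
exists d => // N.
(* Taking [x >= 2] makes [ln x] positive, so the quotient can be cleared. *)
have : (d%:E < ereal_sup [set log_density_seq R A x | x in [set x | (maxn 2 N <= x)%N]]%classic)%E.
  apply: lt_le_trans dL _; apply: ereal_inf_lbound.
  by exists [set x | (maxn 2 N <= x)%N]%classic => //; exists (maxn 2 N).
move=> /ereal_sup_gt[_ [x /= Nx <-]]; rewrite lte_fin => dx.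
move: Nx; rewrite geq_max => /andP[x2 Nx]; exists x => //.
by move: dx; rewrite ltr_pdivlMr ?ln_gt0 ?ltr1n // => /ltW.
Qed.

Lemma ln_nat_ge (M : R) : exists N, forall x, (N <= x)%N -> M <= ln (x%:R : R).
Proof.
exists (Num.truncn (expR M)).+1 => x Nx.
have h : expR M <= x%:R by apply: le_trans (ltW (truncnS_gt _)) _; rewrite ler_nat.
by rewrite -ler_expR lnK // posrE (lt_le_trans (expR_gt0 M)).
Qed.

(** The clause [1 < a'] matters if 1 is in [A]: 1 L-divides every positive integer and would leave
    nothing minimal above 1. *)
Definition L_minimal (A : pred nat) (a : nat) : bool :=
  `[< [/\ A a, (1 < a)%N & forall a', A a' -> (1 < a')%N -> in_L a' a -> a' = a] >].

Lemma L_minimal_primitive A : L_primitive (L_minimal A).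
Proof.
split=> [a /asboolP[] //|a a' /asboolP[Aa a1 _] /asboolP[_ _ H] aa'].
exact: H.
Qed.

Lemma L_minimal_cover (A : pred nat) n : A n -> (1 < n)%N ->
  exists2 a, L_minimal A a & in_L a n.
Proof.
elim/ltn_ind: n => n IH An n1.
have [mn|] := boolP (L_minimal A n); first by exists n => //; exact/in_L_refl/ltnW.
move=> /asboolP/not_and3P[//|//|].
move=> /existsNP[a /not_implyP[Aa /not_implyP[a1 /not_implyP[an ne]]]].
have [|b mb ba] := IH a _ Aa a1.
  by rewrite ltn_neqAle dvdn_leq ?(in_L_dvdn an) ?(ltnW n1) // andbT; exact/eqP.
exists b => //; apply: in_L_trans ba an.
by have /asboolP[] := mb.
Qed.

(** The candidates to follow [a]; strictness makes the chain increase and discards only [a]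
    itself. *)
Definition L_above (A : pred nat) (a : nat) : pred nat :=
  fun n => [&& A n, in_Lb a n & (a < n)%N].

(** The partial sums are bounded by 1; choose [K] where they come within [e] of their supremum. *)
Lemma L_density_tail (S : pred nat) (e : R) : L_primitive S -> 0 < e ->
  exists K, forall x, (K <= x)%N -> \sum_(K.+1 <= a < x.+1 | S a) L_density R a <= e.
Proof.
move=> SL e0; set E := range (fun K => \sum_(1 <= a < K.+1 | S a) L_density R a).
have hE : has_sup E.
  by split; [exists (\sum_(1 <= a < 1 | S a) L_density R a); exists 0%N
            |exists 1 => _ [K _ <-]; exact: L_primitive_density_le1].
have [_ [K _ <-] HK] := sup_adherent e0 hE.
exists K => x Kx.
have : \sum_(1 <= a < x.+1 | S a) L_density R a <= sup E.
  by apply: sup_upper_bound => //; exists x.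
by rewrite (@big_cat_nat _ _ _ K.+1 1 x.+1) //=; lra.
Qed.

Lemma not_log_positive A : ~ log_positive A -> forall d : R, 0 < d ->
  exists N, forall x, (N <= x)%N -> \sum_(1 <= n < x.+1 | A n) ninv n <= d * ln x%:R.
Proof.
move=> nA d d0; apply: contrapT => H; apply: nA; exists d => // N.
apply: contrapT => H2; apply: H; exists N => x Nx.
by rewrite leNgt; apply/negP => /ltW h; apply: H2; exists x.
Qed.

(** Each [n > 1] of [A] lies above some minimal element by [L_minimal_cover]; the leading 1 pays for
    [n = 1]. *)
Lemma sum_L_minimal_ge (A : pred nat) x :
  \sum_(1 <= n < x.+1 | A n) ninv n <=
  1 + \sum_(1 <= a < x.+1 | L_minimal A a)
        \sum_(1 <= n < x.+1 | A n && in_Lb a n) ninv n.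
Proof.
rewrite (exchange_big_dep_nat A) /=; last by move=> a n _ _ _ /andP[].
case: x => [|x]; first by rewrite !big_geq ?addr0.
rewrite big_ltn_cond // [X in 1 + X]big_ltn_cond //.
have H : \sum_(2 <= n < x.+2 | A n) ninv n <=
    \sum_(2 <= n < x.+2 | A n) \sum_(1 <= a < x.+2 | L_minimal A a && (A n && in_Lb a n)) ninv n.
  rewrite big_nat_cond [leRHS]big_nat_cond; apply: ler_sum => n /andP[/andP[n1 nx] An].
  have [a ma an] := L_minimal_cover An n1.
  have a1 : (1 < a)%N by have /asboolP[] := ma.
  have an' : (a <= n)%N by apply: dvdn_leq; [exact: ltnW|exact: in_L_dvdn].
  have ai : a \in index_iota 1 x.+2 by rewrite mem_index_iota (ltnW a1) (leq_ltn_trans an').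
  rewrite big_mkcond (bigD1_seq a ai (iota_uniq _ _)) /=.
  rewrite ma An /= (_ : in_Lb a n) ?lerDl; last exact/asboolP.
  by apply: sumr_ge0 => i _; case: ifP => // _; exact: ninv_ge0.
case: ifP => A1; last by lra.
have : 0 <= \sum_(1 <= a < x.+2 | L_minimal A a && (true && in_Lb a 1)) ninv 1.
  by apply: sumr_ge0 => i _; exact: ninv_ge0.
by rewrite ninv1; lra.
Qed.

(* Since the [L_a] with [a] minimal in [A] have summable densities, the large [a]
   contribute little, so finitely many of them must carry positive density. *)
Lemma log_positive_L_above A : log_positive A ->
  exists a, [/\ A a, (1 < a)%N & log_positive (L_above A a)].
Proof.
move=> [d d0 Hd]; apply: contrapT => H.
have nA a : L_minimal A a -> ~ log_positive (L_above A a).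
  by move=> /asboolP[Aa a1 _] pa; apply: H; exists a.
set C : R := 2 * expR 4.
have C0 : 0 < C by rewrite mulr_gt0 ?expR_gt0.
(* Budget: the minimal [a > K] together, and the minimal [a <= K] together, may each use
   [d / 4 * ln x], apart from bounded terms. *)
have e0 : 0 < d / (4 * C) by rewrite divr_gt0 ?mulr_gt0.
have [K HK] := L_density_tail (L_minimal_primitive A) e0.
have k0 : 0 < d / (4 * K.+1%:R) by rewrite divr_gt0 ?mulr_gt0.
have /choice[Nf HNf] a : exists N, L_minimal A a -> forall x, (N <= x)%N ->
    \sum_(1 <= n < x.+1 | L_above A a n) ninv n <= d / (4 * K.+1%:R) * ln x%:R.
  have [ma|_] := boolP (L_minimal A a); last by exists 0%N.
  by have [N HN] := not_log_positive (nA a ma) k0; exists N.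
(* This threshold makes the bounded terms, at most [2 * K.+1], smaller than a further
   [d / 4 * ln x]. *)
have [N1 HN1] := ln_nat_ge (1 + 8 * K.+1%:R / d).
have [x Nx dx] := Hd (maxn K (maxn N1 (\max_(a < K.+1) Nf a)))%N.
move: Nx; rewrite !geq_max => /and3P[Kx N1x /bigmax_leqP Nfx].
have lx := HN1 x N1x.
have q0 : 0 < 8 * K.+1%:R / d by rewrite divr_gt0 ?mulr_gt0.
have lx1 : 1 <= ln (x%:R : R) by lra.
have lx2 : 2 * K.+1%:R < d / 4 * ln (x%:R : R).
  have -> : 2 * K.+1%:R = d / 4 * (8 * K.+1%:R / d) by field; lra.
  by rewrite ltr_pM2l; lra.
have f0 : 0 <= 1 + d / (4 * K.+1%:R) * ln x%:R.
  by apply: addr_ge0 => //; apply: mulr_ge0; [exact: ltW|exact: le_trans lx1].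
have := le_trans dx (sum_L_minimal_ge A x).
rewrite (@big_cat_nat _ _ _ K.+1 1 x.+1) //=.
have small : \sum_(1 <= a < K.+1 | L_minimal A a)
    \sum_(1 <= n < x.+1 | A n && in_Lb a n) ninv n <=
    K%:R * (1 + d / (4 * K.+1%:R) * ln x%:R).
  apply: (@le_trans _ _ (\sum_(1 <= a < K.+1 | L_minimal A a)
      (1 + d / (4 * K.+1%:R) * ln x%:R))); last first.
    rewrite big_mkcond /=; apply: (@le_trans _ _ (\sum_(1 <= a < K.+1)
      (1 + d / (4 * K.+1%:R) * ln x%:R))); last first.
      by rewrite sumr_const_nat subn1 (mulr_natl _ K).
    apply: ler_sum => a _; case: ifP => // _; exact: f0.
  rewrite big_nat_cond [leRHS]big_nat_cond; apply: ler_sum => a /andP[/andP[a0 aK] ma].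
  apply: le_trans (lerD (lexx 1) (HNf a ma x (Nfx (Ordinal aK) isT))).
  have ai : a \in index_iota 1 x.+1 by rewrite mem_index_iota a0 ltnS (leq_trans _ Kx).
  (* The term [n = a], absent from [L_above A a], contributes at most 1. *)
  rewrite [leLHS]big_mkcond (bigD1_seq a ai (iota_uniq _ _)) /=.
  apply: lerD.
    case: ifP => // _; rewrite invf_le1 ?ltr0n // ler1n //.
  rewrite [leRHS]big_mkcond /= big_mkcond /= big_nat_cond [leRHS]big_nat_cond.
  apply: ler_sum => n /andP[/andP[n0 _] _]; rewrite /L_above.
  case: ifP => na; last by case: ifP => // _; exact: ninv_ge0.
  case: ifP => [/andP[-> an]|_]; last by case: ifP => // _; exact: ninv_ge0.
  rewrite an /= ifT // ltn_neqAle eq_sym na /=; apply: dvdn_leq => //.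
  by move: an => /asboolP; exact: in_L_dvdn.
have tail : \sum_(K.+1 <= a < x.+1 | L_minimal A a)
    \sum_(1 <= n < x.+1 | A n && in_Lb a n) ninv n <= d / 4 * ln x%:R.
  apply: (@le_trans _ _ (\sum_(K.+1 <= a < x.+1 | L_minimal A a)
      L_density R a * (C * ln x%:R))).
    rewrite big_nat_cond [leRHS]big_nat_cond; apply: ler_sum => a /andP[/andP[Ka ax] ma].
    have a1 : (1 < a)%N by have /asboolP[] := ma.
    have aa : (1 < a <= x)%N by rewrite a1 -ltnS.
    apply: le_trans (ler_wpM2l (L_density_ge0 R a) (euler_prod_le lx1)).
    apply: le_trans (L_sum_le R aa).
    rewrite big_mkcond [leRHS]big_mkcond /=; apply: ler_sum => n _.
    by case: (A n) => //=; case: ifP => // _; exact: ninv_ge0.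
  rewrite -big_distrl /=.
  have -> : d / 4 * ln x%:R = d / (4 * C) * (C * ln x%:R) by field; rewrite gt_eqF.
  by rewrite ler_wpM2r ?HK // mulr_ge0 ?(ltW C0) // (le_trans ler01).
have e : K%:R * (1 + d / (4 * K.+1%:R) * ln x%:R) <= K.+1%:R + d / 4 * ln x%:R.
  apply: (@le_trans _ _ (K.+1%:R * (1 + d / (4 * K.+1%:R) * ln x%:R))).
    by rewrite ler_wpM2r ?ler_nat ?f0.
  rewrite le_eqVlt; apply/orP; left; apply/eqP; field.
  by rewrite addrC natr1 pnatr_eq0.
have K1 : (1 : R) <= K.+1%:R by rewrite ler1n.
have dl : 0 < d / 4 * ln (x%:R : R) by rewrite mulr_gt0 //; lra.
have {e}small := le_trans small e.
(* Together the bounds give [d * ln x < 3 * (d / 4) * ln x], a contradiction. *)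
move: tail small lx2 K1 dl => /=.
set S1 := \sum_(1 <= a < K.+1 | _) _; set S2 := \sum_(K.+1 <= a < x.+1 | _) _.
move: S1 S2 (K.+1%:R : R) (ln _) => S1 S2 k l; clear; lra.
Qed.

End ChainStep.

(** * Building the infinite chain by dependent choice *)

Theorem theorem1p8 (R : realType) (A : pred nat) :
  (0 < upper_log_density R A)%E ->
  exists d : nat -> nat, L_chain d /\ (forall j, A (d j)).
Proof.
move=> /log_positive_of_upper_log_density pA.
(* A state holds the set of remaining candidates and the number chosen last. *)
pose T := {p : pred nat * nat | log_positive R p.1 /\ forall n, p.1 n -> A n}.
pose step (s t : T) := [/\ (sval s).1 (sval t).2, (1 < (sval t).2)%N &
  (sval t).1 = L_above (sval s).1 (sval t).2].
have ex (s : T) : {t : T | step s t}.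
  apply: cid; case: s => [[B b] /= [pB BA]].
  have [a [Ba a1 pa]] := log_positive_L_above pB.
  have h : log_positive R (L_above B a) /\ forall n, L_above B a n -> A n.
    by split=> // n /and3P[/BA].
  by exists (exist _ (L_above B a, a) h).
have [f [_ Hf]] := dependent_choice ex (exist _ (A, 0%N) (conj pA (fun _ => id))).
(* The number 0 in the initial state is a dummy, hence the shift of the index. *)
exists (fun j => (sval (f j.+1)).2); split; last first.
  by move=> j; have [+ _ _] := Hf j; case: (svalP (f j)) => _; exact.
have above j : L_above (sval (f j)).1 (sval (f j.+1)).2 (sval (f j.+2)).2.
  by have [_ _ <-] := Hf j; have [] := Hf j.+1.
split; first by have [] := Hf 0%N.
by split=> j; have /and3P[_ /asboolP] := above j.
Qed.
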